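(* Let $\vec U(t)$ be a smooth solution of the semi-discrete summation-by-parts scheme (without boundary penalty terms) $$\mathbf{P}\,\vec U_t+\mathbf{D_x}(\mathbf{A_1}\vec U)+\mathbf{A_1^T}\mathbf{D_x}\vec U+\mathbf{D_y}(\mathbf{A_2}\vec U)+\mathbf{A_2^T}\mathbf{D_y}\vec U=0,$$ where the matrices $\mathbf{A_1},\mathbf{A_2}$ may or may not depend on the solution $\vec U$ (nonlinear or linear case). Then the scheme is energy conserving, in the sense that the energy rate depends only on boundary terms: $$\frac12\frac{d}{dt}\|\vec U\|^2_{\mathbf{P}\tilde{\mathbf{P}}}+\vec U^T\mathbf{B_x}(\mathbf{A_1}\vec U)+\vec U^T\mathbf{B_y}(\mathbf{A_2}\vec U)=0 .$$
   Context: The scheme is a semi-discretisation of the two-dimensional problem $PU_t+(A_1U)_x+A_1^TU_x+(A_2U)_y+A_2^TU_y=0$, where $U=(U_1,\dots,U_n)^T$, $P$ is a constant real symmetric positive definite (or semi-definite) $n\times n$ matrix, and $A_1,A_2$ are real $n\times n$ matrices whose entries are smooth functions of $U$ (nonlinear case) or of another given smooth vector function (linear case). Grid: a tensor-product grid with nodes $(x_k,y_l)$, $k=1,\dots,N$, $l=1,\dots,M$. The vector $\vec U=(\vec U_1^T,\dots,\vec U_n^T)^T$ contains the approximations of $U_1,\dots,U_n$ at all the nodes. For $A=A_1$ or $A_2$ with entries $a_{ij}$, $\mathbf{A}$ is the $n\times n$ block matrix with blocks $\mathbf{a_{ij}}=\mathrm{diag}(a_{ij}(x_1,y_1),\dots,a_{ij}(x_N,y_M))$,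 the diagonal matrix of node values of $a_{ij}$ (ordered consistently with the components of $\vec U_j$); $\mathbf{A^T}$ is the transpose of $\mathbf{A}$. Operators: $I_n,I_x,I_y$ are identity matrices of sizes $n,N,M$, and $\otimes$ is the Kronecker product. $D_x=P_x^{-1}Q_x$ and $D_y=P_y^{-1}Q_y$ are one-dimensional summation-by-parts difference operators of sizes $N\times N$ and $M\times M$: $P_x,P_y$ are positive definite diagonal quadrature matrices and $Q_x+Q_x^T=B_x$, $Q_y+Q_y^T=B_y$, where $B_x,B_y=\mathrm{diag}[-1,0,\dots,0,1]$ of the appropriate sizes. Moreover $$\mathbf{P}=P\otimes I_x\otimes I_y,\quad \mathbf{D_x}=I_n\otimes D_x\otimes I_y,\quad \mathbf{D_y}=I_n\otimes I_x\otimes D_y,$$ $$\tilde{\mathbf{P}}=I_n\otimes P_x\otimes P_y,\quad \mathbf{B_x}=I_n\otimes B_x\otimes P_y,\quad \mathbf{B_y}=I_n\otimes P_x\otimes B_y,$$ and $\|\vec U\|^2_{\mathbf{P}\tilde{\mathbf{P}}}=\vec U^T(\mathbf{P}\tilde{\mathbf{P}})\vec U$. The terms $\vec U^T\mathbf{B_x}\vec W$ and $\vec U^T\mathbf{B_y}\vec W$ contain numerical integration along the boundaries of the rectangular domain. *)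

(* Defs.v *)
From mathcomp Require Import all_boot all_order all_algebra.
From mathcomp Require Export mxtens.
From mathcomp Require Import all_classical all_reals all_analysis.

Set Implicit Arguments.
Unset Strict Implicit.
Unset Printing Implicit Defensive.

Import Order.TTheory GRing.Theory Num.Theory.
Import numFieldNormedType.Exports.

Local Open Scope classical_set_scope.
Local Open Scope ring_scope.

(* C^oo on an open set: every iterated directional derivative (the directions
   are listed in vs) is differentiable there. *)
Definition smooth_on (R : realType) (V W : normedModType R) (O : set V)
    (f : V -> W) : Prop :=
  open O /\
  forall (vs : seq V) (z : V), O z ->
    differentiable (foldr (fun (v : V) (g : V -> W) => 'D_v g) f vs) z.

Definition symmetric_mx (R : realType) (m : nat) (A : 'M[R]_m) : Prop :=
  A^T = A.

Definition quad_form (R : realType) (m : nat) (A : 'M[R]_m) (v : 'cV[R]_m) : R :=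
  (v^T *m A *m v) 0 0.

Definition posdef_mx (R : realType) (m : nat) (A : 'M[R]_m) : Prop :=
  forall v : 'cV[R]_m, v != 0 -> 0 < quad_form A v.

Definition possemidef_mx (R : realType) (m : nat) (A : 'M[R]_m) : Prop :=
  forall v : 'cV[R]_m, 0 <= quad_form A v.

(* diag[-1, 0, ..., 0, 1], meant for 2 <= m *)
Definition boundary_mx (R : realType) (m : nat) : 'M[R]_m :=
  diag_mx (\row_(i < m) ((i.+1 == m)%:R - (i == 0 :> nat)%:R)).

Definition sbp_operator (R : realType) (m : nat) (D P Q : 'M[R]_m) : Prop :=
  [/\ D = invmx P *m Q, is_diag_mx P, posdef_mx P
    & Q + Q^T = boundary_mx R m].

(* The vector of unknowns has its components grouped by variable: the value of
   U_(j+1) at the node (x_k, y_l) has index (j, (k, l)), flattened in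
   lexicographic order, which is the order used by the Kronecker product. *)
Definition node_value (R : realType) (n N M : nat) (u : 'cV[R]_(n * (N * M)))
    (k : 'I_N) (l : 'I_M) : 'cV[R]_n :=
  \col_j u (mxtens_index (j, mxtens_index (k, l))) 0.

(* Nonlinear A stands for the coefficient A(U(x, y, t)), and Linear A V for
   A(V(x, y, t)) with V a given function. *)
Inductive coefficient (R : realType) (n : nat) : Type :=
| Nonlinear (A : 'cV[R]_n -> 'M[R]_n)
| Linear (m : nat) (A : 'cV[R]_m -> 'M[R]_n) (V : R * R * R -> 'cV[R]_m).

(* The state spaces O (and the domain G of V) are allowed to be proper open
   subsets, so that entries such as sqrt(U_1) or 1 / U_1 are covered. *)
Definition smooth_coefficient (R : realType) (n N M : nat)
    (x : 'I_N -> R) (y : 'I_M -> R) (J : set R)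
    (U : R -> 'cV[R]_(n * (N * M))) (c : coefficient R n) : Prop :=
  match c with
  | Nonlinear A =>
      exists O : set 'cV[R]_n,
        (forall i j, smooth_on O (fun w => A w i j)) /\
        (forall t k l, J t -> O (node_value (U t) k l))
  | Linear m A V =>
      exists (O : set 'cV[R]_m) (G : set (R * R * R)),
        [/\ forall i j, smooth_on O (fun w => A w i j),
            smooth_on G V,
            forall p, G p -> O (V p)
          & forall t k l, J t -> G (x k, y l, t)]
  end.

Definition coef_at_node (R : realType) (n N M : nat)
    (c : coefficient R n) (x : 'I_N -> R) (y : 'I_M -> R) (t : R)
    (u : 'cV[R]_(n * (N * M))) (k : 'I_N) (l : 'I_M) : 'M[R]_n :=
  match c with
  | Nonlinear A => A (node_value u k l)
  | Linear m A V => A (V (x k, y l, t))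
  end.

(* The n x n block matrix whose (i, j) block is the diagonal matrix of the node
   values of a_ij. *)
Definition block_coef (R : realType) (n N M : nat)
    (c : coefficient R n) (x : 'I_N -> R) (y : 'I_M -> R) (t : R)
    (u : 'cV[R]_(n * (N * M))) : 'M[R]_(n * (N * M)) :=
  \sum_(i < n) \sum_(j < n)
    delta_mx i j *t
    diag_mx (\row_(q < N * M)
      coef_at_node c x y t u (mxtens_unindex q).1 (mxtens_unindex q).2 i j).

Section Operators.
Variables (R : realType) (n N M : nat).

Definition bold_P (P : 'M[R]_n) : 'M[R]_(n * (N * M)) :=
  P *t ((1%:M : 'M[R]_N) *t (1%:M : 'M[R]_M)).

Definition bold_Dx (Dx : 'M[R]_N) : 'M[R]_(n * (N * M)) :=
  (1%:M : 'M[R]_n) *t (Dx *t (1%:M : 'M[R]_M)).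

Definition bold_Dy (Dy : 'M[R]_M) : 'M[R]_(n * (N * M)) :=
  (1%:M : 'M[R]_n) *t ((1%:M : 'M[R]_N) *t Dy).

Definition tilde_P (Px : 'M[R]_N) (Py : 'M[R]_M) : 'M[R]_(n * (N * M)) :=
  (1%:M : 'M[R]_n) *t (Px *t Py).

Definition bold_Bx (Py : 'M[R]_M) : 'M[R]_(n * (N * M)) :=
  (1%:M : 'M[R]_n) *t (boundary_mx R N *t Py).

Definition bold_By (Px : 'M[R]_N) : 'M[R]_(n * (N * M)) :=
  (1%:M : 'M[R]_n) *t (Px *t boundary_mx R M).

End Operators.
Arguments bold_P {R n} N M P.
Arguments bold_Dx {R} n {N} M Dx.
Arguments bold_Dy {R} n N {M} Dy.
Arguments tilde_P {R} n {N M} Px Py.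
Arguments bold_Bx {R} n N {M} Py.
Arguments bold_By {R} n {N} M Px.

(* Main.v *)
Require Import Defs.
From mathcomp Require Import all_boot all_order all_algebra.
From mathcomp Require Import all_classical all_reals all_analysis.
Import Order.TTheory GRing.Theory Num.Theory.
Import numFieldNormedType.Exports.
Local Open Scope classical_set_scope.
Local Open Scope ring_scope.

Set Implicit Arguments.
Unset Strict Implicit.

(** Multiply the scheme from the left by U^T H, where H is the quadrature matrix
    [tilde_P].  Since H commutes with [bold_P], the time derivative gives half
    the energy rate.  For each direction the remaining two terms are
    U^T H D (A U) + U^T H A^T (D U), where S = H D satisfies the
    multidimensional summation-by-parts rule S + S^T = B.  The matrix H is
    diagonal and weights all the unknowns at a given node equally, while A
    couples only unknowns at the same node, so H commutes with A^T
    ([block_coef_comm]).  The second term is then (A U)^T S U, the transpose of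
    U^T S^T (A U), and the two terms add up to the boundary term U^T B (A U)
    ([split_form_energy]).  The difference operators obey no product
    rule, and none is used: the two halves of the split form are skew-adjoint
    to each other up to the boundary. *)

(** * Matrix algebra *)

Lemma mx11_tr (R : Type) (A : 'M[R]_1) : A^T = A.
Proof. by apply/matrixP => i j; rewrite mxE !ord1. Qed.

(** A nonzero vector in the kernel of A would be a zero of its quadratic
    form. *)
Lemma posdef_unitmx (R : realType) (m : nat) (A : 'M[R]_m) :
  posdef_mx A -> A \in unitmx.
Proof.
move=> Apos; rewrite -row_free_unit -kermx_eq0; apply/negPn/negP.
move=> /rowV0Pn[v /sub_kermxP vA v0].
have /Apos : v^T != 0 by rewrite -(inj_eq trmx_inj) trmxK trmx0.
by rewrite /quad_form trmxK vA mul0mx mxE ltxx.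
Qed.

Lemma is_diag_mx_tr (R : nmodType) (m : nat) (A : 'M[R]_m) :
  is_diag_mx A -> A^T = A.
Proof. by move=> /diag_mxP[d ->]; rewrite tr_diag_mx. Qed.

Lemma sbp_mulmx (R : realType) (m : nat) (D P Q : 'M[R]_m) :
  sbp_operator D P Q -> P *m D = Q.
Proof. by case=> -> _ /posdef_unitmx uP _; rewrite mulmxA mulmxV // mul1mx. Qed.

Lemma tensmxDl (R : pzRingType) (m n p q : nat) (A B : 'M[R]_(m, n))
    (C : 'M[R]_(p, q)) : (A + B) *t C = A *t C + B *t C.
Proof. by apply/matrixP => i j; rewrite !mxE mulrDl. Qed.

Lemma tensmxDr (R : pzRingType) (m n p q : nat) (A : 'M[R]_(m, n))
    (B C : 'M[R]_(p, q)) : A *t (B + C) = A *t B + A *t C.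
Proof. by apply/matrixP => i j; rewrite !mxE mulrDr. Qed.

Lemma is_diag_tensmx (R : pzRingType) (m n : nat) (A : 'M[R]_m) (B : 'M[R]_n) :
  is_diag_mx A -> is_diag_mx B -> is_diag_mx (A *t B).
Proof.
move=> /is_diag_mxP dA /is_diag_mxP dB; apply/is_diag_mxP => i j ij.
case: (mxtens_indexP i) ij => i1 i2; case: (mxtens_indexP j) => j1 j2 ij.
rewrite tensmxE; have [e1|n1] := eqVneq i1 j1; last by rewrite dA ?mul0r.
have [e2|n2] := eqVneq i2 j2; last by rewrite dB ?mulr0.
by rewrite e1 e2 eqxx in ij.
Qed.

(** Each block of the coefficient matrix is diagonal, and diagonal matrices
    commute. *)
Lemma block_coef_comm (R : realType) (n N M : nat) (c : coefficient R n)
    (x : 'I_N -> R) (y : 'I_M -> R) (t : R) (u : 'cV[R]_(n * (N * M)))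
    (W : 'M[R]_(N * M)) :
  is_diag_mx W ->
  comm_mx (1%:M *t W) (block_coef c x y t u).
Proof.
move=> /diag_mxP[d ->]; apply: comm_mx_sum => i _; apply: comm_mx_sum => j _.
by rewrite /comm_mx !tensmx_mul mul1mx mulmx1 diag_mxC.
Qed.

(** * Summation by parts for the split form *)

(** The discrete integration by parts of a skew-symmetric splitting: H D plays
    the role of the integral of a derivative, and B that of the boundary
    integral. *)
Lemma split_form_energy (R : comPzRingType) (m : nat) (H D A B : 'M[R]_m)
    (u : 'cV[R]_m) :
  H^T = H -> comm_mx H A -> H *m D + (H *m D)^T = B ->
  u^T *m H *m (D *m (A *m u) + A^T *m (D *m u)) = u^T *m B *m (A *m u).
Proof.
move=> Hsym HA <-; have HAT : H *m A^T = A^T *m H.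
  by rewrite -{1}Hsym -trmx_mul -HA trmx_mul Hsym.
rewrite mulmxDr mulmxDr mulmxDl; congr (_ + _); first by rewrite !mulmxA.
(* both sides are 1 x 1, hence equal to their transposes *)
rewrite -[RHS]mx11_tr !trmx_mul !trmxK -!mulmxA; congr (_ *m _).
by rewrite !mulmxA HAT.
Qed.

Section TensorGrid.
Context (R : realType) (n N M : nat) (Dx Px Qx : 'M[R]_N) (Dy Py Qy : 'M[R]_M).
Hypotheses (hx : sbp_operator Dx Px Qx) (hy : sbp_operator Dy Py Qy).

Let H := tilde_P n Px Py.

Lemma tilde_P_tr : H^T = H.
Proof.
case: hx hy => _ /is_diag_mx_tr ePx _ _ [_ /is_diag_mx_tr ePy _ _].
by rewrite /H /tilde_P !trmx_tens trmx1 ePx ePy.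
Qed.

Lemma tilde_P_block_coef_comm (c : coefficient R n) x y t u :
  comm_mx H (block_coef c x y t u).
Proof.
by case: hx hy => _ dPx _ _ [_ dPy _ _]; apply/block_coef_comm/is_diag_tensmx.
Qed.

Lemma sbp_bold_Dx :
  H *m bold_Dx n M Dx + (H *m bold_Dx n M Dx)^T = bold_Bx n N Py.
Proof.
have eQ := sbp_mulmx hx.
case: hx hy => _ _ _ eB [_ /is_diag_mx_tr ePy _ _].
rewrite /H /tilde_P /bold_Dx /bold_Bx -eB !tensmx_mul eQ !mulmx1.
by rewrite !trmx_tens trmx1 ePy -tensmxDr -tensmxDl.
Qed.

Lemma sbp_bold_Dy :
  H *m bold_Dy n N Dy + (H *m bold_Dy n N Dy)^T = bold_By n M Px.
Proof.
have eQ := sbp_mulmx hy.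
case: hx hy => _ /is_diag_mx_tr ePx _ _ [_ _ _ eB].
rewrite /H /tilde_P /bold_Dy /bold_By -eB !tensmx_mul eQ !mulmx1.
by rewrite !trmx_tens trmx1 ePx -tensmxDr -tensmxDr.
Qed.

Lemma bold_P_tilde_P_comm (P : 'M[R]_n) : comm_mx (bold_P N M P) H.
Proof.
by rewrite /comm_mx /H /tilde_P /bold_P !tensmx_mul !mulmx1 !mul1mx.
Qed.

Lemma bold_P_tilde_P_tr (P : 'M[R]_n) :
  symmetric_mx P -> (bold_P N M P *m H)^T = bold_P N M P *m H.
Proof.
move=> Psym; rewrite trmx_mul tilde_P_tr bold_P_tilde_P_comm.
by rewrite /bold_P !trmx_tens !trmx1 Psym.
Qed.

End TensorGrid.

(** * Differentiation of a quadratic form along a curve *)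

Lemma is_derive_bilinear (R : realType) (m : nat) (A : 'M[R]_m)
    (u v : R -> 'cV[R]_m) (t : R) (du dv : 'cV[R]_m) :
  is_derive t (1 : R) u du -> is_derive t (1 : R) v dv ->
  is_derive t (1 : R) (fun s => ((u s)^T *m A *m v s) 0 0)
    ((du^T *m A *m v t) 0 0 + ((u t)^T *m A *m dv) 0 0).
Proof.
have coord (w : R -> 'cV[R]_m) dw i : is_derive t (1 : R) w dw ->
    is_derive t (1 : R) (fun s => w s i 0) (dw i 0).
  move=> [wt <-]; apply: DeriveDef; first by move/derivable_mxP: wt => /(_ i 0).
  by rewrite derive_mx // mxE.
have bilE (w z : 'cV[R]_m) :
    (w^T *m A *m z) 0 0 = \sum_i \sum_j A j i * (w j 0 * z i 0).
  rewrite mxE; apply: eq_bigr => i _; rewrite mxE mulr_suml.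
  by apply: eq_bigr => j _; rewrite mxE mulrCA mulrA.
move=> hu hv.
have -> : (fun s => ((u s)^T *m A *m v s) 0 0) =
    \sum_i \sum_j A j i \*: ((fun s => u s j 0) * (fun s => v s i 0)).
  apply/funext => s; rewrite bilE fct_sumE; apply: eq_bigr => i _.
  by rewrite fct_sumE.
rewrite !bilE -big_split; apply: is_derive_sum => i /=.
rewrite -big_split; apply: is_derive_sum => j /=.
have hM := is_deriveM (coord _ _ j hu) (coord _ _ i hv).
apply: (is_derive_eq (is_deriveZ _ hM)).
by rewrite /GRing.scale /= -mulrDr addrC [v t i 0 * _]mulrC.
Qed.

Lemma is_derive_quad_form (R : realType) (m : nat) (A : 'M[R]_m)
    (u : R -> 'cV[R]_m) (t : R) (du : 'cV[R]_m) :
  A^T = A -> is_derive t (1 : R) u du ->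
  is_derive t (1 : R) (fun s => quad_form A (u s))
    (2 * ((u t)^T *m A *m du) 0 0).
Proof.
move=> Asym hu; apply: (is_derive_eq (is_derive_bilinear A hu hu)).
rewrite mulr_natl mulr2n; congr (_ + _).
by rewrite -[du^T *m _ *m _]mx11_tr !trmx_mul trmxK Asym mulmxA.
Qed.

(** * Energy conservation *)

Theorem mainTheorem3 (R : realType) (n N M : nat)
    (hn : (1 <= n)%N) (hN : (2 <= N)%N) (hM : (2 <= M)%N)
    (x : 'I_N -> R) (y : 'I_M -> R)
    (P : 'M[R]_n) (hPsym : symmetric_mx P)
    (hP : posdef_mx P \/ possemidef_mx P)
    (Dx Px Qx : 'M[R]_N) (hx : sbp_operator Dx Px Qx)
    (Dy Py Qy : 'M[R]_M) (hy : sbp_operator Dy Py Qy)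
    (c1 c2 : coefficient R n)
    (J : set R) (U : R -> 'cV[R]_(n * (N * M)))
    (hU : smooth_on J U)
    (hc1 : smooth_coefficient x y J U c1)
    (hc2 : smooth_coefficient x y J U c2)
    (A1 A2 : R -> 'M[R]_(n * (N * M)))
    (hA1 : forall t, A1 t = block_coef c1 x y t (U t))
    (hA2 : forall t, A2 t = block_coef c2 x y t (U t))
    (scheme : forall t, J t ->
       bold_P N M P *m derive1 U t
       + bold_Dx n M Dx *m (A1 t *m U t)
       + (A1 t)^T *m (bold_Dx n M Dx *m U t)
       + bold_Dy n N Dy *m (A2 t *m U t)
       + (A2 t)^T *m (bold_Dy n N Dy *m U t) = 0) :
  let energy := fun t : R => quad_form (bold_P N M P *m tilde_P n Px Py) (U t) in
  forall t : R, J t ->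
    derivable energy t 1 /\
    1 / 2 * derive1 energy t
    + ((U t)^T *m bold_Bx n N Py *m (A1 t *m U t)) 0 0
    + ((U t)^T *m bold_By n M Px *m (A2 t *m U t)) 0 0 = 0.
Proof.
move=> energy t Jt.
have Ut : is_derive t (1 : R) U (derive1 U t).
  rewrite derive1E; apply/derivableP/diff_derivable.
  exact: (hU.2 [::] t Jt).
have hE := is_derive_quad_form (bold_P_tilde_P_tr hx hy hPsym) Ut.
split; first by case: hE.
rewrite derive1E /energy (@derive_val _ _ _ _ _ _ _ hE).
rewrite mulrA mul1r mulVf ?pnatr_eq0 // mul1r.
have Hsym := tilde_P_tr n hx hy.
have HA1 : comm_mx (tilde_P n Px Py) (A1 t).
  by rewrite hA1; apply: (tilde_P_block_coef_comm hx hy).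
have HA2 : comm_mx (tilde_P n Px Py) (A2 t).
  by rewrite hA2; apply: (tilde_P_block_coef_comm hx hy).
have Ex := split_form_energy (U t) Hsym HA1 (sbp_bold_Dx n hx hy).
have Ey := split_form_energy (U t) Hsym HA2 (sbp_bold_Dy n hx hy).
have : (U t)^T *m tilde_P n Px Py *m (bold_P N M P *m derive1 U t
    + (bold_Dx n M Dx *m (A1 t *m U t) + (A1 t)^T *m (bold_Dx n M Dx *m U t))
    + (bold_Dy n N Dy *m (A2 t *m U t) + (A2 t)^T *m (bold_Dy n N Dy *m U t)))
    = 0.
  by rewrite !addrA scheme // mulmx0.
rewrite mulmxDr Ey mulmxDr Ex mulmxA -(mulmxA (U t)^T (tilde_P n Px Py)).
by rewrite -bold_P_tilde_P_comm => /matrixP/(_ 0 0); rewrite !mxE.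
Qed.
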